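(* $V_8 = 34.5399155$.
   Context: For an integer $n\ge 2$, $C_n$ denotes the set of real cosine polynomials $f(\phi)=\sum_{k=0}^{n} a_k\cos(k\phi)$ such that (i) all coefficients $a_0,\dots,a_n$ are real and nonnegative, (ii) $a_1>a_0>0$, and (iii) $f(\phi)\ge 0$ for all real $\phi$. For $f\in C_n$ put $v(f)=\dfrac{f(0)-a_0}{(\sqrt{a_1}-\sqrt{a_0})^2}$, and define $V_n=\inf_{f\in C_n} v(f)$. Numerical constants are decimal values as given in the paper, to seven decimal places. *)

(* Defs.v *)
From Stdlib Require Import Reals.
From Coquelicot Require Import Coquelicot.
Open Scope R_scope.

(* A cosine polynomial of degree at most [n] is given by its coefficients
   [a 0, ..., a n], which the function determines; the values [a k] with
   [k > n] are never used. [sum_f_R0 u n] is [u 0 + ... + u n]. *)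
Definition cos_poly (n : nat) (a : nat -> R) (phi : R) : R :=
  sum_f_R0 (fun k => a k * cos (INR k * phi)) n.

(* Meant for [n >= 2]. *)
Definition in_C (n : nat) (a : nat -> R) : Prop :=
  (forall k : nat, (k <= n)%nat -> 0 <= a k) /\
  a 0%nat < a 1%nat /\
  0 < a 0%nat /\
  (forall phi : R, 0 <= cos_poly n a phi).

Definition v (n : nat) (a : nat -> R) : R :=
  (cos_poly n a 0 - a 0%nat) / (sqrt (a 1%nat) - sqrt (a 0%nat)) ^ 2.

Definition V (n : nat) : Rbar :=
  Glb_Rbar (fun x : R => exists a : nat -> R, in_C n a /\ x = v n a).

(* Main.v *)
Require Import Defs.
From Stdlib Require Import Reals.
From Coquelicot Require Import Coquelicot.
From Stdlib Require Import QArith Qreals List Lia Lra.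
Import ListNotations.
Open Scope R_scope.

(* Lower bound: a positive measure mu on the circle with moments
   m_k = int cos (k phi) dmu <= 1 for 2 <= k <= n gives, by integrating f,
   f(0) - a_0 >= (1 - m_1) a_1 - m_0 a_0. With a_0 = 1 and a_1 = x^2, this implies
   f(0) - a_0 >= V (x - 1)^2 wherever a certain quadratic in x is nonnegative.
   A single mu does not reach all x, because (sqrt a_1 - sqrt a_0)^2 is convex in
   (a_0, a_1); but nine atomic measures with rational masses and rational
   values of cos phi at the atoms together cover x >= 1.
   Upper bound: f = |sum_j b_j e^(i j phi)|^2 with integers b_j. *)

(** * Chebyshev evaluation of cosines over the rationals *)

(* The pair (T_k c, T_(k+1) c) of Chebyshev polynomials. *)
Fixpoint cheb (k : nat) (c : Q) : Q * Q :=
  match k with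
  | O => (1, c)%Q
  | S k' => let (p, q) := cheb k' c in (q, Qred (2 * c * q - p))
  end.

Lemma Q2R_red (q : Q) : Q2R (Qred q) = Q2R q.
Proof. apply Qeq_eqR, Qred_correct. Qed.

Lemma cos_three_term (k : nat) (t : R) :
  cos (INR (S (S k)) * t) =
  2 * cos t * cos (INR (S k) * t) - cos (INR k * t).
Proof.
  replace (INR (S (S k)) * t) with (INR (S k) * t + t) by (rewrite !S_INR; ring).
  replace (INR k * t) with (INR (S k) * t - t) by (rewrite !S_INR; ring).
  rewrite cos_plus, cos_minus; ring.
Qed.

Lemma cheb_cos (k : nat) (c : Q) :
  -1 <= Q2R c <= 1 ->
  Q2R (fst (cheb k c)) = cos (INR k * acos (Q2R c)) /\
  Q2R (snd (cheb k c)) = cos (INR (S k) * acos (Q2R c)).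
Proof.
  intros Hc; induction k as [|k IH]; cbn [cheb].
  - cbn [fst snd INR]; rewrite Rmult_0_l, cos_0, Rmult_1_l, cos_acos by exact Hc.
    split; [exact RMicromega.Q2R_1 | reflexivity].
  - destruct (cheb k c) as [p q]; cbn [fst snd] in *.
    destruct IH as [IHp IHq]; split; [exact IHq|].
    rewrite cos_three_term, <- IHp, <- IHq, (cos_acos _ Hc).
    rewrite Q2R_red, Q2R_minus, !Q2R_mult.
    replace (Q2R 2) with 2 by (unfold Q2R; simpl; lra); reflexivity.
Qed.

(** * Atomic measures and the linear inequalities they give *)

(* An atomic measure on the circle: the pairs (w, c) are the masses w of the
   atoms and the cosines c of their angles. *)
Definition measure := list (Q * Q).

Fixpoint moment (mu : measure) (k : nat) : Q :=
  match mu with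
  | [] => 0
  | (w, c) :: mu' => Qred (w * fst (cheb k c) + moment mu' k)
  end.

Definition positive_measure (mu : measure) : bool :=
  forallb (fun wc => Qle_bool 0 (fst wc) && Qle_bool (-1) (snd wc) &&
                     Qle_bool (snd wc) 1)%bool mu.

Lemma Qle_bool_Q2R (p q : Q) : Qle_bool p q = true -> Q2R p <= Q2R q.
Proof. intros H; apply Qle_Rle, Qle_bool_iff, H. Qed.

(** The sum is the integral of [f] against [mu]: an atom [(w, c)] contributes [w] times the value of
    [f] at [acos c]. *)
Lemma moments_nonneg (n : nat) (a : nat -> R) (mu : measure) :
  (forall phi, 0 <= cos_poly n a phi) -> positive_measure mu = true ->
  0 <= sum_f_R0 (fun k => a k * Q2R (moment mu k)) n.
Proof.
  intros Hf; induction mu as [|[w c] mu IH]; intros Hmu.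
  - rewrite (sum_eq _ (fun _ => 0)), sum_cte by
      (intros; simpl; rewrite RMicromega.Q2R_0; ring); lra.
  - cbn in Hmu; apply andb_prop in Hmu as [Hwc Hmu].
    apply andb_prop in Hwc as [Hwc Hc1]; apply andb_prop in Hwc as [Hw Hc0].
    apply Qle_bool_Q2R in Hw, Hc0, Hc1.
    rewrite RMicromega.Q2R_0 in Hw; rewrite RMicromega.Q2R_1 in Hc1.
    assert (Hc : -1 <= Q2R c <= 1) by (unfold Q2R in Hc0 at 1; simpl in Hc0; lra).
    rewrite (sum_eq _ (fun k => a k * cos (INR k * acos (Q2R c)) * Q2R w
                                + a k * Q2R (moment mu k))).
    + rewrite sum_plus, <- scal_sum.
      apply Rplus_le_le_0_compat; [|exact (IH Hmu)].
      apply Rmult_le_pos; [exact Hw | exact (Hf _)].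
    + intros k _; cbn [moment].
      rewrite Q2R_red, Q2R_plus, Q2R_mult, (proj1 (cheb_cos k c Hc)); ring.
Qed.

Definition feasible (n : nat) (mu : measure) : bool :=
  (positive_measure mu &&
   forallb (fun k => Qle_bool (moment mu k) 1) (seq 2 (n - 1)))%bool.

Lemma feasible_bound (n : nat) (a : nat -> R) (mu : measure) :
  (1 <= n)%nat -> in_C n a -> feasible n mu = true ->
  a 1%nat * (1 - Q2R (moment mu 1)) - a 0%nat * Q2R (moment mu 0)
  <= cos_poly n a 0 - a 0%nat.
Proof.
  intros Hn (Ha & _ & _ & Hf) Hmu.
  apply andb_prop in Hmu as [Hpos Hmom].
  assert (Hm : forall k, (2 <= k <= n)%nat -> Q2R (moment mu k) <= 1).
  { intros k Hk; rewrite <- RMicromega.Q2R_1; apply Qle_bool_Q2R.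
    rewrite forallb_forall in Hmom; apply Hmom, in_seq; lia. }
  pose proof (moments_nonneg n a mu Hf Hpos) as H0.
  (* The integral is subtracted from [f(0)], the sum of the [a_k]; feasibility makes the terms
     [a_k (1 - m_k)] with [k >= 2] nonnegative. *)
  assert (H1 : forall m, (1 <= m <= n)%nat ->
    a 0%nat * (1 - Q2R (moment mu 0)) + a 1%nat * (1 - Q2R (moment mu 1))
    <= sum_f_R0 a m - sum_f_R0 (fun k => a k * Q2R (moment mu k)) m).
  { intros m [H1m Hmn]; induction m as [|[|m] IH]; [lia| |].
    - cbn [sum_f_R0]; lra.
    - rewrite !(tech5 _ (S m)).
      assert (0 <= a (S (S m)) * (1 - Q2R (moment mu (S (S m))))).
      { apply Rmult_le_pos; [apply Ha; lia|].
        specialize (Hm (S (S m)) ltac:(lia)); lra. }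
      specialize (IH ltac:(lia) ltac:(lia)); lra. }
  specialize (H1 n ltac:(lia)).
  replace (cos_poly n a 0) with (sum_f_R0 a n); [lra|].
  apply sum_eq; intros k _; rewrite Rmult_0_r, cos_0; ring.
Qed.

(** * Covering the half-line [x >= 1] *)

(* [gap V mu x] is the amount by which [mu] proves the inequality
   f(0) - a_0 >= V (sqrt a_1 - sqrt a_0)^2 at a_0 = 1, a_1 = x^2. *)
Definition gap (V : Q) (mu : measure) (x : Q) : Q :=
  (x * x * (1 - moment mu 1) - moment mu 0 - V * ((x - 1) * (x - 1)))%Q.

Definition gapR (V : Q) (mu : measure) (x : R) : R :=
  x * x * (1 - Q2R (moment mu 1)) - Q2R (moment mu 0) - Q2R V * ((x - 1) * (x - 1)).

Lemma Q2R_gap (V : Q) (mu : measure) (x : Q) :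
  Q2R (gap V mu x) = gapR V mu (Q2R x).
Proof.
  unfold gap, gapR; rewrite !Q2R_minus, !Q2R_mult, !Q2R_minus, RMicromega.Q2R_1; ring.
Qed.

(* [gap V mu] is a quadratic polynomial with leading coefficient
   1 - m_1 - V. When that is nonpositive the gap is concave, and two endpoints
   control an interval; when it is nonnegative, the gap is increasing on x >= 0. *)
Fixpoint covers (n : nat) (V lo : Q) (table : list (measure * Q)) (last : measure) : bool :=
  match table with
  | [] =>
      feasible n last && Qle_bool V (1 - moment last 1) &&
      Qle_bool 0 lo && Qle_bool 0 (gap V last lo)
  | (mu, hi) :: table' =>
      feasible n mu && Qle_bool (1 - moment mu 1) V &&
      Qle_bool 0 (gap V mu lo) && Qle_bool 0 (gap V mu hi) &&
      covers n V hi table' last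
  end.

Lemma covers_sound (n : nat) (V : Q) (table : list (measure * Q)) (last : measure)
  (lo : Q) (x : R) :
  covers n V lo table last = true -> 0 <= Q2R V -> Q2R lo <= x ->
  exists mu, feasible n mu = true /\ 0 <= gapR V mu x.
Proof.
  intros H HV; revert lo H.
  induction table as [|[mu hi] table IH]; intros lo H Hx; cbn [covers] in H.
  - apply andb_prop in H as [H Hgap]; apply andb_prop in H as [H Hlo].
    apply andb_prop in H as [Hmu Hslope].
    exists last; split; [exact Hmu|].
    apply Qle_bool_Q2R in Hgap, Hlo, Hslope.
    rewrite RMicromega.Q2R_0 in Hgap, Hlo; rewrite Q2R_gap in Hgap.
    rewrite Q2R_minus, RMicromega.Q2R_1 in Hslope.
    unfold gapR in *.
    (* The product is the gap at [x] minus the gap at [lo], factored. *)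
    assert (0 <= (x - Q2R lo) * ((x + Q2R lo) * (1 - Q2R (moment last 1) - Q2R V)
                                 + 2 * Q2R V)).
    { apply Rmult_le_pos; [lra|].
      apply Rplus_le_le_0_compat; [apply Rmult_le_pos|]; lra. }
    lra.
  - apply andb_prop in H as [H Hrest]; apply andb_prop in H as [H Hhi].
    apply andb_prop in H as [H Hlo]; apply andb_prop in H as [Hmu Hslope].
    apply Qle_bool_Q2R in Hlo, Hhi, Hslope.
    rewrite RMicromega.Q2R_0, Q2R_gap in Hlo, Hhi.
    rewrite Q2R_minus, RMicromega.Q2R_1 in Hslope.
    destruct (Rle_or_lt (Q2R hi) x) as [Hx'|Hx'].
    + exact (IH hi Hrest Hx').
    + exists mu; split; [exact Hmu|].
      unfold gapR in *.
      set (p := 1 - Q2R (moment mu 1)) in *; set (q := Q2R (moment mu 0)) in *.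
      set (l := Q2R lo) in *; set (h := Q2R hi) in *; set (W := Q2R V) in *.
      assert (Hlh : 0 < h - l) by lra.
      apply Rmult_le_reg_l with (1 := Hlh); rewrite Rmult_0_r.
      (* Concavity made explicit: the last summand is the excess of the gap over its chord, times
         [h - l]. *)
      replace ((h - l) * (x * x * p - q - W * ((x - 1) * (x - 1)))) with
        ((h - x) * (l * l * p - q - W * ((l - 1) * (l - 1))) +
         (x - l) * (h * h * p - q - W * ((h - 1) * (h - 1))) +
         (W - p) * ((x - l) * (h - x) * (h - l))) by ring.
      repeat apply Rplus_le_le_0_compat; repeat apply Rmult_le_pos; lra.
Qed.

(* Numerical solutions of the linear program dual to minimizing f(0) at fixed
   a_1 / a_0 = x^2, for x to the left of, at, and to the right of the optimal
   x = 1.3157726. Past x = 1.445 the last measure suffices, since a_1 / a_0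
   cannot exceed 2 cos (pi / 10). *)
Definition dual_table : list (measure * Q) := (
  [([], 1.2049);
   ([(2.5009, -1); (3.1486, -0.8117); (3.1262, -0.316)],
    1.307);
   ([(4.542181026, -0.965665464); (3.363475236, -0.676292094); (2.84640422, -0.189343151)],
    1.315);
   ([(4.628443782, -0.96468457); (3.41658447, -0.672385687); (2.848120508, -0.182271323)],
    1.3157);
   ([(4.63582761084, -0.96460275808); (3.42118793582, -0.67206741062); (2.84842669169, -0.18167275577)],
    1.31577);
   ([(4.636913502047, -0.964590754608); (3.421865621793, -0.672020814089); (2.848473820813, -0.181584825162)],
    1.315803);
   ([(4.654424525, -0.964398176); (3.432817455, -0.671276805); (2.849307979, -0.180170346)],
    1.3174);
   ([(5.781700223, -0.955070988); (4.1639025, -0.644633205); (3.134493829, -0.107006627)],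
    1.445)])%Q.

Definition dual_last : measure :=
  ([(53.4028, -0.9529);
   (43.1429, -0.603);
   (26.5591, -0.0364);
   (10.0443, 0.5327)])%Q.

(** The constant is the claimed value minus 4e-8, which leaves room for a strict error bound of
    5e-8. *)
Lemma dual_table_covers : covers 8 34.53991546 1 dual_table dual_last = true.
Proof. vm_compute; reflexivity. Qed.

Lemma v_lower_bound (a : nat -> R) : in_C 8 a -> 34.53991546 <= v 8 a.
Proof.
  intros Ha; pose proof Ha as (_ & H01 & H0 & _).
  set (r0 := sqrt (a 0%nat)); set (r1 := sqrt (a 1%nat)).
  assert (Hr0 : 0 < r0) by (apply sqrt_lt_R0; lra).
  assert (Hr : r0 < r1) by (apply sqrt_lt_1; lra).
  assert (E0 : a 0%nat = r0 * r0) by (symmetry; apply sqrt_sqrt; lra).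
  assert (E1 : a 1%nat = r1 * r1) by (symmetry; apply sqrt_sqrt; lra).
  destruct (covers_sound 8 34.53991546 dual_table dual_last 1 (r1 / r0)
              dual_table_covers) as (mu & Hmu & Hgap).
  { lra. }
  { rewrite RMicromega.Q2R_1; apply Rlt_le, Rlt_div_r; lra. }
  pose proof (feasible_bound 8 a mu ltac:(lia) Ha Hmu) as Hb.
  unfold v; fold r0 r1.
  apply (Rle_div_r _ _ ((r1 - r0) ^ 2)); [apply pow_lt; lra|].
  refine (Rle_trans _ _ _ _ Hb); rewrite E0, E1.
  unfold gapR in Hgap.
  (* Multiplying by [a_0] undoes the normalization [a_0 = 1], by homogeneity. *)
  apply (Rmult_le_compat_l (r0 * r0)) in Hgap; [|nra].
  rewrite Rmult_0_r in Hgap.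
  match type of Hgap with _ <= ?t => replace t with
    (r1 * r1 * (1 - Q2R (moment mu 1)) - r0 * r0 * Q2R (moment mu 0)
     - 34.53991546 * (r1 - r0) ^ 2) in Hgap by (field; lra) end.
  lra.
Qed.

(** * Upper bound by an explicit squared modulus *)

Definition autocorrelation (n : nat) (b : nat -> R) (k : nat) : R :=
  (if Nat.eqb k 0 then 1 else 2) * sum_f_R0 (fun j => b j * b (j + k)%nat) (n - k).

(** In the expanded squares, index pairs at distance [k] yield [cos (k phi)] by the subtraction
    formula; for [k > 0] they occur in both orders, hence the factor 2. *)
Lemma cos_poly_autocorrelation (b : nat -> R) (phi : R) :
  cos_poly 8 (autocorrelation 8 b) phi =
  Rsqr (sum_f_R0 (fun j => b j * cos (INR j * phi)) 8) +
  Rsqr (sum_f_R0 (fun j => b j * sin (INR j * phi)) 8).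
Proof.
  assert (Hcos : forall j k, cos (INR k * phi) =
    cos (INR (j + k) * phi) * cos (INR j * phi) +
    sin (INR (j + k) * phi) * sin (INR j * phi)).
  { intros j k; rewrite <- cos_minus, plus_INR; f_equal; ring. }
  assert (Hterm : forall k, autocorrelation 8 b k * cos (INR k * phi) =
    (if Nat.eqb k 0 then 1 else 2) *
    sum_f_R0 (fun j => b j * b (j + k)%nat *
      (cos (INR (j + k) * phi) * cos (INR j * phi) +
       sin (INR (j + k) * phi) * sin (INR j * phi))) (8 - k)).
  { intros k; unfold autocorrelation.
    rewrite Rmult_assoc, (Rmult_comm (sum_f_R0 _ _)), scal_sum; f_equal.
    apply sum_eq; intros j _; rewrite <- Hcos; reflexivity. }
  unfold cos_poly; rewrite (sum_eq _ _ 8 (fun k _ => Hterm k)).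
  cbn [sum_f_R0 Nat.sub Nat.add Nat.eqb]; unfold Rsqr.
  ring.
Qed.

(* The b_j come from a Fejer-Riesz factorization of the numerical minimizer,
   which has a_5 = a_6 = 0; they are perturbed so that these two
   coefficients come out slightly positive after rounding. *)
Definition near_minimizer : nat -> R :=
  autocorrelation 8 (fun j => nth j
    [15949884; -14688602; -31534558; 91266517; 356266470; 588836478; 596841256;
     380525187; 124630420] 0).

Lemma near_minimizer_in_C : in_C 8 near_minimizer.
Proof.
  repeat split.
  - intros k Hk; unfold near_minimizer, autocorrelation.
    do 9 (destruct k as [|k]; [cbn; lra|]); lia.
  - unfold near_minimizer, autocorrelation; cbn; lra.
  - unfold near_minimizer, autocorrelation; cbn; lra.
  - intros phi; unfold near_minimizer; rewrite cos_poly_autocorrelation.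
    apply Rplus_le_le_0_compat; apply Rle_0_sqr.
Qed.

Lemma v_near_minimizer : v 8 near_minimizer < 34.5399155 + 5e-8.
Proof.
  (* The integers are scaled so that the two roots are near 10^9 and 1.3157726 * 10^9; these decimal
     bounds keep the denominator of [v] from below. *)
  assert (H0 : sqrt (near_minimizer 0) <= 999999999.59).
  { rewrite <- (sqrt_square 999999999.59) by lra; apply sqrt_le_1_alt.
    unfold near_minimizer, autocorrelation; cbn; lra. }
  assert (H1 : 1315772631.26 <= sqrt (near_minimizer 1)).
  { rewrite <- (sqrt_square 1315772631.26) by lra; apply sqrt_le_1_alt.
    unfold near_minimizer, autocorrelation; cbn; lra. }
  unfold v; apply Rlt_div_l; [apply Rlt_gt, pow_lt; lra|].
  apply Rlt_le_trans with
    ((34.5399155 + 5e-8) * (1315772631.26 - 999999999.59) ^ 2).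
  - unfold cos_poly; rewrite (sum_eq _ near_minimizer) by
      (intros; rewrite Rmult_0_r, cos_0; ring).
    unfold near_minimizer, autocorrelation; cbn; lra.
  - apply Rmult_le_compat_l; [lra|]; apply pow_incr; lra.
Qed.

(* A value given to seven decimal places is off by less than half a unit of
   the seventh place. *)
Theorem theorem1p2 :
  is_finite (V 8) /\ Rabs (real (V 8) - 34.5399155) < 5e-8.
Proof.
  destruct (Glb_Rbar_correct (fun x => exists a, in_C 8 a /\ x = v 8 a)) as [Hlb Hglb].
  fold (V 8) in Hlb, Hglb.
  specialize (Hlb _ (ex_intro _ _ (conj near_minimizer_in_C eq_refl))).
  specialize (Hglb (Finite 34.53991546)).
  pose proof v_near_minimizer as Hv.
  destruct (V 8) as [l| |]; cbn in *.
  - split; [reflexivity|].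
    assert (34.53991546 <= l) by
      (apply Hglb; intros x (a & Ha & ->); apply v_lower_bound, Ha).
    apply Rabs_def1; lra.
  - contradiction.
  - exfalso; apply Hglb; intros x (a & Ha & ->); apply v_lower_bound, Ha.
Qed.
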